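(* Let $n\ge2$. Then $$\mathrm{ch}\,\mathrm{SDT}(-\infty)=\mathrm{ch}\,U_q^+\bigl(\mathfrak q(n)\bigr),$$ that is, $$\sum_{T\in\mathrm{SDT}(-\infty)}e^{\mathrm{wt}(T)}=\frac{\prod_{\alpha\in\Phi^+}(1+e^{\alpha})}{\prod_{\alpha\in\Phi^+}(1-e^{\alpha})}.$$
   Context: $\epsilon_1,\dots,\epsilon_n$ is the standard basis of $\mathbb Z^n$ and $\Phi^+=\{\epsilon_i-\epsilon_j:1\le i<j\le n\}$; formal characters are formal sums of $e^\beta$ with $\beta$ in the cone $\mathbb Z_{\ge0}\Phi^+$, and $1/(1-e^\alpha)=\sum_{m\ge0}e^{m\alpha}$. $U_q^+(\mathfrak q(n))$ is the upper half of the quantum group of the queer Lie superalgebra $\mathfrak q(n)$, graded by weight; its character is $\mathrm{ch}\,U_q^+(\mathfrak q(n))=\mathrm{ch}\,U_q^+(\mathfrak{gl}(n))\prod_{\alpha\in\Phi^+}(1+e^\alpha)=\prod_{\alpha\in\Phi^+}\frac{1+e^\alpha}{1-e^\alpha}$ (known). A word $u_1\cdots u_N$ is a hook word if $u_1\ge\cdots\ge u_k<u_{k+1}<\cdots<u_N$ for some $1\le k\le N$. A semistandard decomposition tableau is a filling, with letters in $\{1,\dots,n\}$, of a shifted diagram with strictly decreasing row lengths (the $k$-th row from the top shifted $k-1$ units to the right) such that, with $v_k$ the $k$-th row from the top read left to right, each nonempty $v_k$ is a hook word and $v_k$ is a hook subword (not necessarily contiguous) of maximal length in the concatenation $v_{k+1}v_k$.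 It is dual marginally large if it has $n$ (nonempty) rows and, for each $1\le i\le n$, the number of leftmost $i$-boxes in row $n-i+1$ (the length of the maximal initial run of $i$'s; rows counted from the top) exceeds the total number of boxes of row $n-i+2$ by exactly one (row $n+1$ is empty). $\mathrm{SDT}(-\infty)$ is the set of all dual marginally large semistandard decomposition tableaux. For $T\in\mathrm{SDT}(-\infty)$, let $L_T$ be the tableau of the same shape whose $k$-th row from the top is filled with $n+1-k$; then $\mathrm{wt}(T)=\sum_{j=1}^n(\#j\text{ in }T-\#j\text{ in }L_T)\,\epsilon_j$. *)

(* Defs.v *)
From HB Require Import structures.
From mathcomp Require Import all_boot all_order all_algebra.
From mathcomp Require Import all_classical.

Set Implicit Arguments.
Unset Strict Implicit.
Unset Printing Implicit Defensive.

Import Order.TTheory GRing.Theory Num.Theory.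

Local Open Scope classical_set_scope.
Local Open Scope ring_scope.

Definition eps n (i : 'I_n) : 'rV[int]_n := delta_mx 0 i.

Definition posroots n : seq 'rV[int]_n :=
  [seq eps p.1 - eps p.2
     | p : 'I_n * 'I_n in [pred p : 'I_n * 'I_n | (p.1 < p.2)%N]].

Definition poscone n : set 'rV[int]_n :=
  [set b | exists m : 'rV[int]_n -> nat, b = \sum_(a <- posroots n) a *+ m a].
Arguments poscone n : clear implicits.

(* The formal sum of the [f b] e^b is represented by its coefficient function
   [f]. Addition is pointwise, but the product is the convolution [fmul], not
   the pointwise product that the library puts on functions. *)
Definition fchar n := 'rV[int]_n -> int.

Definition fexp n (b : 'rV[int]_n) : fchar n := fun c => (c == b)%:R.

(* The sum is finitely supported when [f] and [g] vanish outside [poscone n]: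
   only finitely many c have both c and b - c in the cone. *)
Definition fmul n (f g : fchar n) : fchar n :=
  fun b => \sum_(c \in [set: 'rV[int]_n]) f c * g (b - c).

(* The order of the factors is irrelevant for series supported in the cone. *)
Definition fbigmul n (s : seq 'rV[int]_n) (F : 'rV[int]_n -> fchar n) : fchar n :=
  \big[@fmul n/@fexp n 0]_(a <- s) F a.

(* The sum of e^(w i) over i in A; the coefficient at b is the number of i in A
   with w i = b. It is meaningful under [fsummable] (a sum over an infinite
   support is 0 by convention). *)
Definition fsum n (I : choiceType) (A : set I) (w : I -> 'rV[int]_n) : fchar n :=
  fun b => \sum_(i \in A `&` [set i | w i = b]) (1 : int).

Definition fsummable n (I : choiceType) (A : set I) (w : I -> 'rV[int]_n) :
    Prop :=
  (forall i, A i -> poscone n (w i)) /\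
  (forall b, finite_set (A `&` [set i | w i = b])).

(* 1 / (1 - e^a), expanded in the direction of a *)
Definition fgeom n (a : 'rV[int]_n) : fchar n :=
  fsum [set: nat] (fun m => a *+ m).

(* The characters of U_q^+(gl(n)) and U_q^+(q(n)), given by their known product
   formulas; the algebras themselves are not constructed. *)
Definition ch_Uplus_gl n : fchar n := fbigmul (posroots n) (@fgeom n).
Arguments ch_Uplus_gl n : clear implicits.

Definition ch_Uplus_q n : fchar n :=
  fmul (ch_Uplus_gl n)
       (fbigmul (posroots n) (fun a c => fexp 0 c + fexp a c)).
Arguments ch_Uplus_q n : clear implicits.

(* The letter i of {1, ..., n} is the ordinal i - 1. A tableau is the list of
   its nonempty rows, from top to bottom, each read from left to right; the
   shift of the rows is determined by their positions in the list. Rows are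
   numbered from 0, and the rows below the last one are empty. *)
Definition tableau n := seq (seq 'I_n).

Definition trow n (T : tableau n) (k : nat) : seq 'I_n := nth [::] T k.

Definition shifted_shape n (T : tableau n) : bool :=
  sorted gtn (map size T) && (0 \notin map size T)%N.

(* The bottom u_k of the hook belongs to both the decreasing and the increasing
   part. *)
Definition hook_word n (u : seq 'I_n) : bool :=
  [exists k : 'I_(size u),
     sorted (fun a b : 'I_n => (b <= a)%N) (take k.+1 u) &&
     sorted (fun a b : 'I_n => (a < b)%N) (drop k u)].

Definition max_hook_subword n (v u : seq 'I_n) : Prop :=
  [/\ subseq v u, hook_word v &
      forall w, subseq w u -> hook_word w -> (size w <= size v)%N].

Definition is_SDT n (T : tableau n) : Prop :=
  shifted_shape T /\
  forall k, (k < size T)%N ->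
    hook_word (trow T k) /\
    max_hook_subword (trow T k) (trow T k.+1 ++ trow T k).

Definition initial_run n (i : 'I_n) (v : seq 'I_n) : nat := find (predC1 i) v.

(* In this numbering, row n - i + 1 (counted from 1) of the letter i is the row
   [rev_ord] of the corresponding ordinal. *)
Definition dual_marginally_large n (T : tableau n) : Prop :=
  size T = n /\
  forall i : 'I_n,
    initial_run i (trow T (rev_ord i)) = (size (trow T (rev_ord i).+1)).+1.

Definition SDT_minus_infty n : set (tableau n) :=
  [set T | is_SDT T /\ dual_marginally_large T].
Arguments SDT_minus_infty n : clear implicits.

Definition lowest_tableau n (T : tableau n) : tableau n :=
  [seq nseq (size (trow T k)) (rev_ord k) | k : 'I_n <- enum 'I_n].

Definition wt n (T : tableau n) : 'rV[int]_n :=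
  \sum_(j < n) ((count_mem j (flatten T))%:Z
                - (count_mem j (flatten (lowest_tableau T)))%:Z) *: eps j.

(* Main.v *)
Require Import Defs.
From mathcomp Require Import all_boot all_order all_algebra.
From mathcomp Require Import all_classical.
From mathcomp Require Import zify.

(** Both sides count families of multiplicities of positive roots.

    On the side of tableaux, call row of i the row whose initial run consists of
    the letter i. Since every row starts with its own letter, a letter larger
    than i in the row of i could be put in front of the row above to give a
    longer hook subword; so the row of i only has letters at most i
    ([SDT_tableau_of]). Conversely the condition on hook subwords costs nothing
    more: the initial run of i is longer than the whole row below, while a hook
    subword starting in that row, where all letters are below i, cannot continue
    after a letter i of the run ([hook_subword_bound]). Hence a tableau is the
    same thing as an arbitrary family of row tails, one for each letter i: the
    part after the initial run, which is a hook word with letters at most i that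
    does not begin with i, or is empty. The lengths of the initial runs are then
    forced, and the weight is the sum of eps j - eps i over the letters j of the
    tail of the row of i ([wt_tableau_of]).

    A row tail for i encodes a multiset and a set of letters below i, that is, a
    term of the product over j < i of (1 + x_j) / (1 - x_j). Write the multiset
    in weakly decreasing order and append the set in strictly increasing order:
    the result is a hook word, and each nonempty hook word arises exactly twice,
    with its bottom in either part. The letter i, of weight zero, may or may not
    end a nonempty tail, and this bit separates the two ([row_tail_tail_of],
    [tail_of_inj], [tail_of_surj]).

    On the side of series, all supports lie in the cone, where each element has
    finitely many decompositions because roots have positive height
    ([finite_below]). So a product of series that count indexed families counts
    the families of choices of indices ([fmul_fsum], [fbigmul_fsum]), and the
    character is the generating function of the same pairs of multiplicities
    ([ch_Uplus_q_fsum]). The theorem follows by transport along the bijection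
    ([SDT_of_bij], [wt_SDT_of]). *)

Set Implicit Arguments.
Unset Strict Implicit.
Unset Printing Implicit Defensive.

Import Order.TTheory GRing.Theory Num.Theory.

Local Open Scope classical_set_scope.
Local Open Scope ring_scope.

(** * Roots, heights and the positive cone *)

Section Cone.
Variable n : nat.
Implicit Types (b c : 'rV[int]_n) (p : 'I_n * 'I_n).

Definition root_of p : 'rV[int]_n := eps p.1 - eps p.2.

(** Indexing by pairs of positions rather than by vectors is what lets the
    multiplicities of a root be read off from a tableau. *)
Lemma big_posroots (R : Type) (idx : R) (op : R -> R -> R) (F : 'rV[int]_n -> R) :
  \big[op/idx]_(a <- posroots n) F a =
  \big[op/idx]_(p <- enum [pred p : 'I_n * 'I_n | (p.1 < p.2)%N]) F (root_of p).
Proof. by rewrite /posroots /image_mem big_map. Qed.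

Lemma epsE (i j : 'I_n) : (eps i : matrix _ _ _) 0 j = (i == j)%:R.
Proof. by rewrite /eps mxE eqxx eq_sym. Qed.

Lemma root_ofE p (k : 'I_n) :
  (root_of p : matrix _ _ _) 0 k = (p.1 == k)%:R - (p.2 == k)%:R.
Proof. by rewrite -!epsE !mxE. Qed.

Lemma root_of_inj : {in [pred p : 'I_n * 'I_n | (p.1 < p.2)%N] &, injective root_of}.
Proof.
move=> [i j] [k l]; rewrite !inE /= => ltij ltkl E.
have Ei : root_of (i, j) 0 i = root_of (k, l) 0 i by rewrite E.
have Ej : root_of (i, j) 0 j = root_of (k, l) 0 j by rewrite E.
move: Ei Ej; rewrite !root_ofE /= !eqxx.
have /negbTE -> : j != i by apply/eqP => ji; rewrite ji ltnn in ltij.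
have /negbTE -> : i != j by apply/eqP => ji; rewrite ji ltnn in ltij.
case: eqP => [->|_]; case: eqP => [|_] //.
all: case: eqP => [|_] //; case: eqP => [->|_] //.
Qed.

Lemma poscone0 : poscone n 0.
Proof. by exists (fun=> 0%N); rewrite big1. Qed.

Lemma posconeD b c : poscone n b -> poscone n c -> poscone n (b + c).
Proof.
move=> [m ->] [m' ->]; exists (fun a => (m a + m' a)%N).
by rewrite -big_split; apply: eq_bigr => a _; rewrite mulrnDr.
Qed.

Lemma posconeMn b k : poscone n b -> poscone n (b *+ k).
Proof.
move=> hb; elim: k => [|k IH]; first by rewrite mulr0n; exact: poscone0.
by rewrite mulrS; exact: posconeD.
Qed.

Lemma poscone_root p : (p.1 < p.2)%N -> poscone n (root_of p).
Proof.
move=> hp; exists (fun a => a == root_of p : nat).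
have up : uniq (posroots n).
  rewrite map_inj_in_uniq ?enum_uniq // => x y.
  by rewrite !mem_enum => *; apply: root_of_inj.
have rin : root_of p \in posroots n by apply: map_f; rewrite mem_enum.
rewrite (bigD1_seq _ rin up) /= eqxx mulr1n big1 ?addr0 // => a /negbTE ->.
by rewrite mulr0n.
Qed.

(** The linear form that is 1 on simple roots. Every positive root has height at
    least 1, so an element of the cone is a combination of roots with
    multiplicities at most its height: this is the source of all finiteness. *)
Definition height b : int := \sum_(j < n) - j%:Z * b 0 j.

Lemma heightD b c : height (b + c) = height b + height c.
Proof. by rewrite -big_split; apply: eq_bigr => j _; rewrite mxE mulrDr. Qed.

Lemma heightB b c : height (b - c) = height b - height c.
Proof. by apply/(addIr (height c)); rewrite -heightD !subrK. Qed.

Lemma heightMn b k : height (b *+ k) = height b *+ k.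
Proof.
elim: k => [|k IH]; last by rewrite !mulrS heightD IH.
by rewrite !mulr0n /height big1 // => j _; rewrite mxE mulr0.
Qed.

Lemma height_sum (I : Type) (s : seq I) (F : I -> 'rV[int]_n) :
  height (\sum_(i <- s) F i) = \sum_(i <- s) height (F i).
Proof.
elim: s => [|i s IH]; last by rewrite !big_cons heightD IH.
by rewrite !big_nil -(mulr0n 0) heightMn.
Qed.

Lemma height_eps (i : 'I_n) : height (eps i) = - i%:Z.
Proof.
rewrite /height (bigD1 i) //= epsE eqxx mulr1 big1 ?addr0 // => j ji.
by rewrite epsE eq_sym (negbTE ji) mulr0.
Qed.

Lemma height_root p : (p.1 < p.2)%N -> 1 <= height (root_of p).
Proof.
move=> hp; rewrite heightB !height_eps; lia.
Qed.

Lemma height_ge0 b : poscone n b -> 0 <= height b.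
Proof.
move=> [m ->]; rewrite big_posroots height_sum big_seq sumr_ge0 // => p.
rewrite mem_enum inE => hp.
by rewrite heightMn mulrn_wge0 // (le_trans _ (height_root hp)).
Qed.

Lemma finite_poscone_height (N : nat) :
  finite_set [set c | poscone n c /\ height c <= N%:Z].
Proof.
pose g (f : {ffun 'I_n * 'I_n -> 'I_N.+1}) : 'rV[int]_n :=
  \sum_(p <- enum [pred p : 'I_n * 'I_n | (p.1 < p.2)%N]) root_of p *+ f p.
apply: sub_finite_set (finite_image g (@finite_finset _ setT)) => c [[m ->]].
rewrite big_posroots => hN.
exists [ffun p => inord (m (root_of p))] => //.
rewrite /g big_seq [RHS]big_seq; apply: eq_bigr => p ip; rewrite ffunE inordK //.
move: hN; rewrite height_sum (bigD1_seq p) ?enum_uniq //= heightMn.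
move: ip; rewrite mem_enum inE => hp.
have : 0 <= \sum_(q <- enum [pred p : 'I_n * 'I_n | (p.1 < p.2)%N] | q != p)
    height (root_of q *+ m (root_of q)).
  rewrite big_seq_cond sumr_ge0 // => q /andP[]; rewrite mem_enum inE => hq _.
  by rewrite heightMn mulrn_wge0 // (le_trans _ (height_root hq)).
have := height_root hp; rewrite -mulr_natr.
set h := height _; set k := m _; set s := \sum_(_ <- _ | _) _.
rewrite natz; nia.
Qed.

(** The terms of a convolution at [b] come from this set, which is finite since
    heights are nonnegative on the cone and add up to the height of [b]. *)
Lemma finite_below b : finite_set [set c | poscone n c /\ poscone n (b - c)].
Proof.
apply: sub_finite_set (finite_poscone_height `|height b|) => c [hc hbc].
split=> //; have := height_ge0 hbc; rewrite heightB; lia.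
Qed.

End Cone.

(** * Products of formal characters *)

Section Series.
Variable n : nat.
Implicit Types (b c : 'rV[int]_n).

Lemma fsum_dflt (I : choiceType) (A : set I) (w : I -> 'rV[int]_n) b :
  (forall i, A i -> w i <> b) -> fsum A w b = 0.
Proof.
move=> h; rewrite /fsum (_ : _ `&` _ = set0) ?fsbig_set0 //.
by rewrite -subset0 => i [/= Ai /(h i Ai)].
Qed.

Lemma eq_fsum (I : choiceType) (A : set I) (w v : I -> 'rV[int]_n) :
  {in A, w =1 v} -> fsum A w = fsum A v.
Proof.
move=> h; apply/funext => b; rewrite /fsum; apply: eq_fsbigl.
by apply/seteqP; split=> i [Ai /= <-]; split=> //=; rewrite h // inE.
Qed.

Lemma eq_fsummable (I : choiceType) (A : set I) (w v : I -> 'rV[int]_n) :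
  {in A, w =1 v} -> fsummable A v -> fsummable A w.
Proof.
move=> h [Av finA]; split=> [i Ai|b]; first by rewrite h ?inE //; exact: Av.
by apply: sub_finite_set (finA b) => i [Ai /= <-]; split=> //=; rewrite h ?inE.
Qed.

Lemma fsummableX (I J : choiceType) (A : set I) (B : set J)
    (w : I -> 'rV[int]_n) (v : J -> 'rV[int]_n) :
  fsummable A w -> fsummable B v ->
  fsummable (A `*` B) (fun x => w x.1 + v x.2).
Proof.
move=> [Aw finA] [Bv finB]; split=> [[i j] [/= Ai Bj]|b].
  by apply: posconeD; [exact: Aw|exact: Bv].
have Cfin := finite_below b; set C := [set c | _] in Cfin.
apply: sub_finite_set (bigcup_finite Cfin
  (F := fun c => (A `&` [set i | w i = c]) `*` (B `&` [set j | v j = b - c])) _).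
  move=> [i j] [[/= Ai Bj] /= E].
  have Ej : b - w i = v j by rewrite -E addrAC subrr add0r.
  exists (w i); last by split; split=> //=; rewrite Ej.
  by rewrite /C /= Ej; split; [exact: Aw|exact: Bv].
by move=> c _; exact: finite_setX.
Qed.

(** The coefficient of the product at [b] counts the pairs of indices of total
    weight [b], sorted according to the weight [c] of the first one. *)
Lemma fmul_fsum (I J : choiceType) (A : set I) (B : set J)
    (w : I -> 'rV[int]_n) (v : J -> 'rV[int]_n) :
  fsummable A w -> fsummable B v ->
  fmul (fsum A w) (fsum B v) = fsum (A `*` B) (fun x => w x.1 + v x.2).
Proof.
move=> Aw Bv; have [_ finAB] := fsummableX Aw Bv.
case: Aw Bv => [Aw finA] [Bv finB]; apply/funext => b.
have Cfin := finite_below b; set C := [set c | _] in Cfin.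
(* Outside C one of the two factors vanishes. *)
rewrite /fmul -(@fsbig_widen _ _ _ _ C) //; last first.
  move=> c [_ /= nC]; apply/eqP; rewrite mulf_eq0.
  have [hc|nc] := pselect (poscone n c).
    rewrite (@fsum_dflt _ B) ?eqxx ?orbT // => j Bj E.
    by apply: nC; split=> //; rewrite -E; exact: Bv.
  by rewrite (@fsum_dflt _ A) ?eqxx // => i Ai E; apply: nc; rewrite -E; exact: Aw.
have finX := finAB b; set X := _ `&` _ in finX.
have -> : fsum (A `*` B) (fun x => w x.1 + v x.2) b = \sum_(x \in X) (1 : int).
  by [].
transitivity (\sum_(c \in C) \sum_(x \in X) ((w x.1 == c)%:R : int)).
  apply: eq_fsbigr => c _; rewrite /fsum mulr_fsuml.
  transitivity (\sum_(x \in (A `&` [set i | w i = c]) `*`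
                            (B `&` [set j | v j = b - c])) (1 : int)).
    rewrite -(@pair_fsbig _ _ _ _ _ _ _ (fun _ _ => 1 : int)) //.
    by apply: eq_fsbigr => i _; rewrite mul1r.
  rewrite (_ : _ `*` _ = X `&` [set x | w x.1 = c]); last first.
    apply/seteqP; split=> [[i j] /= [[Ai <-] [Bj E]]|[i j] /= [[[Ai Bj] /= E] <-]].
      by split=> //; split=> //=; rewrite E addrC subrK.
    by split=> //; split=> //; rewrite /= -E addrAC subrr add0r.
  rewrite fsbig_mkcondr; apply: eq_fsbigr => x _.
  by case: eqP => wc; [rewrite mem_set|rewrite memNset].
rewrite exchange_fsbig //; apply: eq_fsbigr => x; rewrite inE => -[[/= Ax Bx] E].
rewrite (fsbigD1 (w x.1)) //=; last first.
  by rewrite /C /= -E addrAC subrr add0r; split; [exact: Aw|exact: Bv].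
rewrite eqxx fsbig1 ?addr0 // => c [_ /= /eqP]; rewrite eq_sym => /negbTE ->.
by [].
Qed.

Lemma fsum_reindex (I J : choiceType) (A : set I) (B : set J) (h : I -> J)
    (w : J -> 'rV[int]_n) :
  set_bij A B h -> fsum B w = fsum A (w \o h).
Proof.
move=> hb; apply/funext => b; rewrite /fsum.
rewrite (reindex_fsbig h (A `&` [set i | w (h i) = b])) //.
case: hb => fh ih sh; split.
- by move=> i [Ai wi]; split=> //; exact: fh.
- by move=> i j; rewrite !inE => -[Ai _] [Aj _]; apply: ih; rewrite inE.
- move=> j [Bj wj]; have [i Ai hij] := sh j Bj.
  by exists i => //; split=> //=; rewrite hij.
Qed.

Lemma fsummable_reindex (I J : choiceType) (A : set I) (B : set J) (h : I -> J)
    (w : J -> 'rV[int]_n) :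
  set_bij A B h -> fsummable A (w \o h) -> fsummable B w.
Proof.
move=> [fh ih sh] [Aw finA]; split=> [j Bj|b].
  by have [i Ai <-] := sh j Bj; exact: Aw.
apply: sub_finite_set (finite_image h (finA b)) => j [Bj /= wj].
by have [i Ai hij] := sh j Bj; exists i => //; split=> //=; rewrite hij.
Qed.

Lemma fsummable1 (I : choiceType) (i0 : I) (w : I -> 'rV[int]_n) :
  poscone n (w i0) -> fsummable [set i0] w.
Proof.
by move=> h; split=> [i -> //|b]; apply: finite_setIl; exact: finite_set1.
Qed.

Lemma fexp_fsum1 (I : choiceType) (i0 : I) (w : I -> 'rV[int]_n) :
  fexp (w i0) = fsum [set i0] w.
Proof.
apply/funext => b; rewrite /fexp; have [->|ne] := eqVneq.
  rewrite /fsum (_ : _ `&` _ = [set i0]) ?fsbig_set1 //.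
  by apply/seteqP; split=> [i []|i ->].
by rewrite fsum_dflt // => i -> E; rewrite E eqxx in ne.
Qed.

(** Expansion of a product of series indexed by the same type: a term of the
    product chooses one index in each factor. A choice is a function on all of
    the index type [P], constant outside the list of factors. *)
Section BigProduct.
Variables (P : finType) (J : choiceType) (j0 : J) (w : P -> J -> 'rV[int]_n).

Definition choices (s : seq P) : set {ffun P -> J} :=
  [set f | forall p, p \notin s -> f p = j0].

Definition set_choice p (x : J * {ffun P -> J}) : {ffun P -> J} :=
  [ffun q => if q == p then x.1 else x.2 q].

Lemma choices_cons p s : p \notin s ->
  set_bij ([set: J] `*` choices s) (choices (p :: s)) (set_choice p).
Proof.
move=> ps; split.
- move=> [j f] [_ /= fs] q; rewrite inE negb_or ffunE => /andP[/negbTE -> qs].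
  exact: fs.
- move=> [j f] [k g]; rewrite !inE => -[_ /= fs] [_ /= gs] /ffunP E.
  have := E p; rewrite !ffunE eqxx /= => ->; congr pair; apply/ffunP => q.
  have := E q; rewrite !ffunE /=; case: eqP => // -> _.
  by rewrite fs ?gs.
- move=> f fs; exists (f p, [ffun q => if q == p then j0 else f q]).
    split=> // q; rewrite /= ffunE; case: eqP => // /eqP qp qs.
    by apply: fs; rewrite inE negb_or qp.
  by apply/ffunP => q; rewrite !ffunE /=; case: eqP => [->|].
Qed.

Lemma fbigmul_fsum (s : seq P) :
  uniq s -> (forall p, p \in s -> fsummable [set: J] (w p)) ->
  fsummable (choices s) (fun f => \sum_(p <- s) w p (f p)) /\
  \big[@fmul n/@fexp n 0]_(p <- s) fsum [set: J] (w p) =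
  fsum (choices s) (fun f => \sum_(p <- s) w p (f p)).
Proof.
elim: s => [|p s IH] /=.
  have -> : choices [::] = [set [ffun=> j0]].
    by apply/seteqP; split=> [f fs|f -> p _]; [apply/ffunP => p|];
      rewrite ffunE // fs.
  split; first by apply: fsummable1; rewrite big_nil; exact: poscone0.
  by rewrite big_nil -fexp_fsum1 big_nil.
move=> /andP[ps us] sums.
have {}[IHs IHe] : _ /\ _ := IH us (fun q qs => sums q (mem_behead (s := p :: s) qs)).
have Sp := sums p (mem_head p s).
have bij := choices_cons ps.
have E : {in [set: J] `*` choices s,
    (fun x : J * {ffun P -> J} => w p x.1 + \sum_(q <- s) w q (x.2 q)) =1
    (fun f : {ffun P -> J} => \sum_(q <- p :: s) w q (f q)) \o set_choice p}.
  move=> [j f] _; rewrite /= big_cons ffunE eqxx; congr (_ + _).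
  rewrite big_seq [RHS]big_seq; apply: eq_bigr => q qs; rewrite ffunE.
  by case: eqP => // qp; rewrite -qp qs in ps.
have SX := fsummableX Sp IHs.
split.
  by apply: (fsummable_reindex bij); apply: eq_fsummable SX => x hx; rewrite E.
by rewrite big_cons IHe fmul_fsum // (fsum_reindex _ bij) (eq_fsum E).
Qed.

End BigProduct.
End Series.

(** * Expansion of the character of the upper half *)

Section Character.
Variable n : nat.

Local Notation pairs := (enum [pred p : 'I_n * 'I_n | (p.1 < p.2)%N]).

Definition mult_weight
    (x : {ffun 'I_n * 'I_n -> nat} * {ffun 'I_n * 'I_n -> bool}) : 'rV[int]_n :=
  \sum_(p <- pairs) root_of p *+ (x.1 p + x.2 p).

Lemma fsummable_geom (p : 'I_n * 'I_n) :
  (p.1 < p.2)%N -> fsummable [set: nat] (fun m => root_of p *+ m).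
Proof.
move=> hp; split=> [m _|b]; first exact/posconeMn/poscone_root.
apply: sub_finite_set (finite_II (`|height b|).+1) => m [_ /= <-].
rewrite heightMn -mulr_natr; have := height_root hp.
by set h := height _; rewrite natz; nia.
Qed.

Lemma fsummable_bool (p : 'I_n * 'I_n) :
  (p.1 < p.2)%N -> fsummable [set: bool] (fun e : bool => root_of p *+ e).
Proof.
by move=> hp; split=> [m _|b]; [exact/posconeMn/poscone_root|exact: finite_finset].
Qed.

Lemma fexpD_fsum (a : 'rV[int]_n) :
  (fun c => fexp 0 c + fexp a c) = fsum [set: bool] (fun e : bool => a *+ e).
Proof.
apply/funext => c; rewrite /fsum fsbig_mkcondr (fsbigE [:: true; false]) //.
  rewrite !big_cons big_nil !in_setT /= addr0 addrC /fexp.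
  have mem e : (e \in [set e : bool | a *+ e = c]) = (c == a *+ e).
    by rewrite eq_sym; apply/idP/eqP => [/set_mem|] //= E; apply/mem_set.
  by congr (_ + _); rewrite mem ?mulr0n ?mulr1n /fexp; case: eqP.
by case.
Qed.

(** The factor 1 / (1 - e^a) chooses a multiplicity and the factor 1 + e^a decides
    whether to take [a] once more. *)
Lemma ch_Uplus_q_fsum :
  let D := choices 0%N pairs `*` choices false pairs in
  fsummable D mult_weight /\ ch_Uplus_q n = fsum D mult_weight.
Proof.
have inP p : p \in pairs -> (p.1 < p.2)%N by rewrite mem_enum.
have up : uniq pairs by exact: enum_uniq.
have [S1 E1] := fbigmul_fsum 0%N up (fun p hp => fsummable_geom (inP p hp)).
have [S2 E2] := fbigmul_fsum false up (fun p hp => fsummable_bool (inP p hp)).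
have E : mult_weight =
    (fun x => \sum_(p <- pairs) root_of p *+ x.1 p +
              \sum_(p <- pairs) root_of p *+ x.2 p).
  apply/funext => x; rewrite -big_split; apply: eq_bigr => p _.
  by rewrite mulrnDr.
move=> D; rewrite E; split; first exact: fsummableX S1 S2.
rewrite /ch_Uplus_q /ch_Uplus_gl /fbigmul !big_posroots.
under [X in fmul _ X]eq_bigr do rewrite fexpD_fsum.
by rewrite E1 E2 fmul_fsum.
Qed.

End Character.

(** * Hook words *)

Section HookWords.
Variable n : nat.
Implicit Types (u v w A B D R : seq 'I_n) (i x y : 'I_n).

Local Notation ge_ord := (fun a b : 'I_n => (b <= a)%N).
Local Notation lt_ord := (fun a b : 'I_n => (a < b)%N).

Lemma ge_ord_trans : transitive ge_ord.
Proof. by move=> a b c; lia. Qed.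

Lemma lt_ord_trans : transitive lt_ord.
Proof. by move=> a b c; lia. Qed.

Lemma hook_wordP u :
  hook_word u <->
  exists D x R, [/\ u = rcons D x ++ R, sorted ge_ord (rcons D x) & path lt_ord x R].
Proof.
split=> [/existsP[k /andP[dec inc]]|[D [x [R [-> dec inc]]]]].
  have x0 : 'I_n by case: (u) k {dec inc} => [|a l] // [].
  move: inc; rewrite (drop_nth x0) // => inc.
  exists (take k u), (nth x0 u k), (drop k.+1 u); split=> //.
    by rewrite -take_nth // cat_take_drop.
  by rewrite -take_nth.
have kP : (size D < size (rcons D x ++ R))%N by rewrite size_cat size_rcons; lia.
apply/existsP; exists (Ordinal kP); apply/andP; split=> /=.
  by rewrite take_size_cat ?size_rcons.
by rewrite cat_rcons drop_size_cat.
Qed.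

(** A weakly decreasing word followed by a strictly increasing one is a hook
    word whatever happens at the junction: the smaller of the two letters
    there is the bottom. This is the form in which subwords are handled. *)
Definition dec_inc u :=
  exists A B, [/\ u = A ++ B, sorted ge_ord A & sorted lt_ord B].

Lemma hook_dec_inc u : hook_word u -> dec_inc u.
Proof.
move=> /hook_wordP[D [x [R [-> dec inc]]]].
by exists (rcons D x), R; split=> //; exact: (path_sorted inc).
Qed.

Lemma rcons_sorted D x y :
  sorted ge_ord (rcons D x) -> (y <= x)%N -> sorted ge_ord (rcons (rcons D x) y).
Proof.
by case: D => [|d D] /= dec yx; rewrite ?yx // rcons_path dec last_rcons yx.
Qed.

Lemma dec_inc_hook u : u != [::] -> dec_inc u -> hook_word u.
Proof.
move=> + [A [B [uE dec inc]]]; rewrite {}uE.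
case/lastP: A dec => [|D x] dec; case: B inc => [|y R] inc // _;
  apply/hook_wordP.
- by exists [::], y, R.
- by exists D, x, [::].
- case: (ltnP x y) => xy; first by exists D, x, (y :: R); rewrite /= xy.
  by exists (rcons D x), y, R; rewrite -cat_rcons; split=> //; exact: rcons_sorted.
Qed.

Lemma dec_inc_subseq u v : subseq u v -> dec_inc v -> dec_inc u.
Proof.
move=> /[swap] -[A [B [-> dec inc]]] /subseqP[m _ ->].
exists (mask (take (size A) m) A), (mask (drop (size A) m) B); split.
- case: (leqP (size A) (size m)) => Am.
    by rewrite -mask_cat ?size_takel // !cat_take_drop.
  rewrite (take_oversize (ltnW Am)) (drop_oversize (ltnW Am)) mask0s cats0.
  by elim: m A Am {dec} => [|b m IH] [|a A] //= Am; rewrite IH.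
- exact: (subseq_sorted ge_ord_trans (mask_subseq _ _) dec).
- exact: (subseq_sorted lt_ord_trans (mask_subseq _ _) inc).
Qed.

(** The first ascent of a hook word belongs to its increasing part. *)
Lemma hook_rise (a b : 'I_n) v : (a < b)%N -> dec_inc [:: a, b & v] -> path lt_ord b v.
Proof.
move=> ab [[|a' [|b' A]] [B [/= E dec inc]]].
- by rewrite -E /= in inc; case/andP: inc.
- by case: E => _ E; rewrite -E in inc.
- by case: E dec => <- <- _ /andP[]; lia.
Qed.

(** * Words in a row after its initial run *)

(** What may follow the initial run of the letter i in the row of that letter;
    the last condition says that the run stops where the tail begins. *)
Definition row_tail i w :=
  [/\ dec_inc w, {in w, forall x, (x <= i)%N} & (w == [::]) || (head i w < i)%N].

Lemma sorted_nseq_cat i r A :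
  {in A, forall x, (x <= i)%N} -> sorted ge_ord A -> sorted ge_ord (nseq r i ++ A).
Proof.
move=> Ai dec; elim: r => [//|r IH] /=.
rewrite path_sortedE; last exact: ge_ord_trans.
rewrite IH andbT all_cat all_nseq leqnn orbT /=.
exact/allP.
Qed.

Lemma row_tail_dec_inc_nseq i w r : row_tail i w -> dec_inc (nseq r i ++ w).
Proof.
move=> [[A [B [-> dec inc]]] le _].
exists (nseq r i ++ A), B; rewrite catA; split=> //; apply: sorted_nseq_cat => //.
by move=> x xA; apply: le; rewrite mem_cat xA.
Qed.

Lemma initial_run_nseq i w r :
  (w == [::]) || (head i w < i)%N -> initial_run i (nseq r i ++ w) = r.
Proof.
move=> hw; rewrite /initial_run find_cat has_nseq /= eqxx andbF size_nseq.
case: w hw => [|x w] /=; first by rewrite addn0.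
by case: eqP => [->|_]; rewrite ?ltnn //= addn0.
Qed.

Lemma row_tail_of_row i u r :
  dec_inc u -> {in u, forall x, (x <= i)%N} -> initial_run i u = r ->
  exists2 w, u = nseq r i ++ w & row_tail i w.
Proof.
move=> hu le <-; exists (drop (initial_run i u) u).
  rewrite -{1}(cat_take_drop (initial_run i u) u); congr (_ ++ _).
  rewrite /initial_run; elim: (u) => [|x l IH] //=.
  by case: eqP => [->|] //=; rewrite -IH.
split; first exact: (dec_inc_subseq (drop_subseq _ _) hu).
  by move=> x /mem_drop; exact: le.
rewrite /initial_run; elim: u le {hu} => [|x l IH] // le /=.
case: (eqVneq x i) => [_|xi] /=; first apply: IH => y yl.
  by apply: le; rewrite inE yl orbT.
by have := le x (mem_head _ _); rewrite leq_eqVlt val_eqE (negbTE xi).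
Qed.

(** The hook condition between two consecutive rows is automatic: a hook subword
    that starts in the lower row can use the long initial run of the upper row
    only once, at its very end. *)
Lemma hook_subword_bound i v w (x : seq 'I_n) :
  {in v, forall y, (y < i)%N} -> {in w, forall y, (y <= i)%N} ->
  subseq x (v ++ nseq (size v).+1 i ++ w) -> dec_inc x ->
  (size x <= size (nseq (size v).+1 i ++ w))%N.
Proof.
move=> vi wi; set u := nseq _ _ ++ _.
have subcat (s s1 s2 : seq 'I_n) : subseq s (s1 ++ s2) ->
    exists t1 t2, [/\ s = t1 ++ t2, subseq t1 s1 & subseq t2 s2].
  move=> /subseqP[m ms ->].
  exists (mask (take (size s1) m) s1), (mask (drop (size s1) m) s2); split.
  - by rewrite -mask_cat ?size_takel ?cat_take_drop // ms size_cat leq_addr.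
  - exact: mask_subseq.
  - exact: mask_subseq.
move=> /subcat[[|y x1] [x2 [-> s1 s2]]] hx; first exact: size_subseq.
move: (s2) => /subcat[x3 [x4 [E s3 s4]]].
have yi : (y < i)%N by apply: vi; apply: (mem_subseq s1); rewrite mem_head.
have := size_subseq s1; have := size_subseq s4; have := size_subseq s3.
rewrite E /u !size_cat !size_nseq.
(* Without letters of the run, x is short enough already. *)
case: x3 E s3 => [|i' x3] E s3; first by rewrite /=; lia.
have /nseqP[/= ii' _] : i' \in nseq (size v).+1 i.
  by apply: (mem_subseq s3); rewrite mem_head.
(* After y < i the word increases, but no letter exceeds i: the i taken from the
   run is the last letter. *)
have rise : path lt_ord i (x3 ++ x4).
  apply: (hook_rise yi); apply: dec_inc_subseq hx.
  rewrite E ii' /= eqxx.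
  by rewrite -[X in subseq X _]cat0s -cat1s cat_subseq ?sub0seq.
case F : (x3 ++ x4) rise => [|z t] /= rise.
  by move: F; case: x3 {E s3} => // /= ->; rewrite /=; lia.
have zi : (z <= i)%N.
  have : z \in x3 ++ x4 by rewrite F mem_head.
  rewrite mem_cat => /orP[zx|/(mem_subseq s4)/wi //].
  have /nseqP[-> //] : z \in nseq (size v).+1 i.
  by apply: (mem_subseq s3); rewrite inE zx orbT.
by case/andP: rise; lia.
Qed.

(** * Row tails as pairs of a multiset and a set *)

(** A pair of a weakly decreasing A and a strictly increasing B, with letters
    below i, gives the hook word A ++ B, but each nonempty hook word has two such
    factorizations, according to the part that contains its bottom. A final
    letter i, which is allowed in a row tail and is of weight zero there, records
    that the bottom is in B. When A is empty, the default value i of last puts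
    the bottom in B. *)
Definition tail_of i A B :=
  A ++ B ++ (if B is b :: _ then nseq (b <= last i A)%N i else [::]).

Definition dec_below i A := sorted ge_ord A /\ {in A, forall x, (x < i)%N}.
Definition inc_below i B := sorted lt_ord B /\ {in B, forall x, (x < i)%N}.

Lemma row_tail_tail_of i A B :
  dec_below i A -> inc_below i B -> row_tail i (tail_of i A B).
Proof.
move=> [dec Ai] [inc Bi]; rewrite /tail_of.
have le1 : {in A ++ B, forall x, (x <= i)%N}.
  by move=> x; rewrite mem_cat => /orP[/Ai|/Bi]; lia.
case: B inc Bi le1 => [|b B] inc Bi le1.
  rewrite !cats0; split=> //; first by exists A, [::]; rewrite cats0.
    by move=> x /Ai; lia.
  by case: (A) Ai => //= a l h; apply: h; rewrite mem_head.
have bi : (b < i)%N by apply: Bi; rewrite mem_head.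
have hd t : ((A ++ (b :: B) ++ t) == [::]) || (head i (A ++ (b :: B) ++ t) < i)%N.
  by case: (A) Ai => //= a l h; apply: h; rewrite mem_head.
split=> //; last first.
  move=> x; rewrite catA mem_cat => /orP[/le1 //|/nseqP[-> _]//].
case: leqP => /= hb; last first.
  by exists A, (b :: B); rewrite cats0.
exists A, (rcons (b :: B) i); split=> //=; first by rewrite cats1.
by rewrite rcons_path; apply/andP; split=> //; apply: Bi; exact: mem_last.
Qed.

Lemma dec_inc_short X : sorted ge_ord X -> sorted lt_ord X -> (size X <= 1)%N.
Proof. by case: X => [|a [|b X]] //= /andP[ba _] /andP[ab _]; lia. Qed.

Lemma cat_eq_prefix (A B A' B' : seq 'I_n) :
  A ++ B = A' ++ B' -> (size A <= size A')%N ->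
  exists2 X, A' = A ++ X & B = X ++ B'.
Proof.
move=> E le; exists (drop (size A) A').
  rewrite -{1}(cat_take_drop (size A) A'); congr (_ ++ _).
  have := congr1 (take (size A)) E; rewrite take_size_cat // take_cat.
  case: ltnP => // ge; have -> : size A = size A' by lia.
  by rewrite subnn take0 take_size cats0.
have := congr1 (drop (size A)) E; rewrite drop_size_cat // drop_cat.
case: ltnP => // ge -> ; have -> : size A = size A' by lia.
by rewrite subnn drop0 drop_size.
Qed.

(** The factorizations can differ by at most one letter, the bottom, and the
    presence of the letter i tells on which side it lies. *)
Lemma tail_of_inj i A B A' B' :
  dec_below i A -> inc_below i B -> dec_below i A' -> inc_below i B' ->
  tail_of i A B = tail_of i A' B' -> A = A' /\ B = B'.
Proof.
wlog le : A B A' B' / (size A <= size A')%N.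
  move=> W dA iB dA' iB' E.
  case: (leqP (size A) (size A')) => [/W|/ltnW /W]; first exact.
  by case/(_ B' B dA' iB' dA iB (esym E)).
move=> [dec Ai] [inc Bi] [dec' Ai'] [inc' Bi']; rewrite /tail_of.
pose t A B := if B is b :: _ then (b <= last i A)%N else false.
have tE C D : (if D is b :: _ then nseq (b <= last i C)%N i else [::]) = nseq (t C D) i.
  by case: D.
rewrite !tE => E.
have mem C D (b : bool) : {in C, forall x, (x < i)%N} -> {in D, forall x, (x < i)%N} ->
    (i \in C ++ D ++ nseq b i) = b.
  move=> Ci Di; rewrite !mem_cat; case: (boolP (i \in C)) => [/Ci|_]; first by lia.
  case: (boolP (i \in D)) => [/Di|_] /=; first by lia.
  by case: b => //=; rewrite mem_head.
have tt : t A B = t A' B' by rewrite -(mem A B (t A B)) // E mem.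
move: (E); rewrite tt !catA => /eqP; rewrite eqseq_cat; last first.
  by have := congr1 size E; rewrite tt !size_cat !addnA => /addIn.
case/andP=> /eqP /cat_eq_prefix - /(_ le)[X A'E BE] _.
have : (size X <= 1)%N.
  apply: dec_inc_short.
    by apply: subseq_sorted dec'; [exact: ge_ord_trans|rewrite A'E suffix_subseq].
  by apply: subseq_sorted inc; [exact: lt_ord_trans|rewrite BE prefix_subseq].
case: X A'E BE => [|x [|//]] A'E BE _; first by rewrite A'E cats0 BE.
exfalso; move: A'E BE; rewrite cats1 cat1s => A'E BE.
have xi : (x < i)%N by apply: Bi; rewrite BE mem_head.
(* The bottom x is in B and in A': the final i is present for (A, B) and absent
   for (A', B'), although the two words are the same. *)
move: tt; rewrite /t BE A'E last_rcons.
have -> : (x <= last i A)%N.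
  move: dec'; rewrite A'E; case: (A) => [|a C] /=; first by lia.
  by rewrite rcons_path => /andP[].
case: B' BE {E inc' Bi'} => // b B' BE; move: inc; rewrite BE /= => /andP[]; lia.
Qed.

Lemma tail_of_surj i w : row_tail i w ->
  exists A B, [/\ dec_below i A, inc_below i B & w = tail_of i A B].
Proof.
move=> [hw le]; have [->|w0 /= hd] := eqVneq w [::].
  by exists [::], [::].
have /hook_wordP[D [x [R [wE dec inc]]]] := dec_inc_hook w0 hw.
have Di : {in rcons D x, forall y, (y < i)%N}.
  move: hd dec; rewrite wE; case: (D) => [|d l] /= hd.
    by move=> _ y; rewrite inE => /eqP ->.
  rewrite path_sortedE; last exact: ge_ord_trans.
  move=> /andP[/allP dl _] y; rewrite inE => /orP[/eqP -> //|/dl /=]; lia.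
have xi : (x < i)%N by apply: Di; rewrite mem_rcons mem_head.
have Rle : {in R, forall y, (y <= i)%N}.
  by move=> y yR; apply: le; rewrite wE mem_cat yR orbT.
have [iR|iR] := boolP (i \in R); last first.
  exists (rcons D x), R; split=> //.
    split; first exact: (path_sorted inc).
    move=> y yR; have := Rle y yR; rewrite leq_eqVlt val_eqE => /orP[/eqP yi|//].
    by rewrite -yi yR in iR.
  rewrite wE /tail_of; case: (R) inc => [|r l] /= => [_|/andP[xr _]].
    by rewrite !cats0.
  by rewrite last_rcons leqNgt xr /= cats0.
(* The increasing part can contain i only as its last letter. *)
have [R' RE] : exists R', R = rcons R' i.
  case/lastP: R iR inc Rle {wE} => // R' y iR inc Rle; exists R'; congr rcons.
  apply/val_inj; apply/eqP; rewrite eqn_leq Rle ?mem_rcons ?mem_head //=.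
  move: iR; rewrite mem_rcons inE => /orP[/eqP -> //|iR].
  have : sorted lt_ord (rcons R' y) by exact: (path_sorted inc).
  have sub : subseq [:: i; y] (rcons R' y).
    by rewrite -cats1; apply: (@cat_subseq _ [:: i] [:: y]); rewrite sub1seq ?mem_head.
  by move=> /(subseq_sorted lt_ord_trans sub) /=; lia.
have inc2 : sorted lt_ord (rcons (x :: R') i) by rewrite /= -RE.
exists D, (x :: R'); split.
- split=> [|y yD]; last by apply: Di; rewrite mem_rcons inE yD orbT.
  by apply: subseq_sorted dec; [exact: ge_ord_trans|rewrite -cats1 prefix_subseq].
- split=> [|y yR].
    by apply: subseq_sorted inc2; [exact: lt_ord_trans|rewrite -cats1 prefix_subseq].
  have sub : subseq [:: y; i] (rcons (x :: R') i).
    by rewrite -cats1; apply: (@cat_subseq _ [:: y] [:: i]); rewrite sub1seq ?mem_head.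
  by have := subseq_sorted lt_ord_trans sub inc2; rewrite /= andbT.
- rewrite wE RE cat_rcons /tail_of /=; congr (_ ++ _ :: _).
  have -> : (x <= last i D)%N.
    move: dec; case: (D) => [|d l] /=; first by move=> _; exact: ltnW.
    by rewrite rcons_path => /andP[].
  by rewrite cats1.
Qed.

(** * Words and multiplicities *)

Definition dec_word (m : 'I_n -> nat) :=
  flatten [seq nseq (m j) j | j <- rev (enum 'I_n)].

Definition inc_word (e : 'I_n -> bool) := [seq j <- enum 'I_n | e j].

Lemma count_dec_word m j : count_mem j (dec_word m) = m j.
Proof.
rewrite /dec_word count_flatten -map_comp sumnE big_map big_rev /=.
rewrite (bigD1_seq j) ?mem_enum ?enum_uniq //= count_nseq /= eqxx mul1n big1 ?addn0 //.
by move=> k kj; rewrite count_nseq /= (negbTE kj).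
Qed.

Lemma mem_dec_word m j : (j \in dec_word m) = (0 < m j)%N.
Proof. by rewrite -has_pred1 has_count count_dec_word. Qed.

Lemma mem_inc_word e j : (j \in inc_word e) = e j.
Proof. by rewrite mem_filter mem_enum andbT. Qed.

Lemma sorted_enum_lt : sorted lt_ord (enum 'I_n).
Proof. by have := iota_ltn_sorted 0 n; rewrite -val_enum_ord sorted_map. Qed.

Lemma sorted_inc_word e : sorted lt_ord (inc_word e).
Proof. exact: (sorted_filter lt_ord_trans _ sorted_enum_lt). Qed.

Lemma sorted_dec_word m : sorted ge_ord (dec_word m).
Proof.
have : sorted (fun a b : 'I_n => (b < a)%N) (rev (enum 'I_n)).
  by rewrite rev_sorted; exact: sorted_enum_lt.
rewrite /dec_word; elim: (rev _) => [|j s IH] //=.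
rewrite path_sortedE; last by move=> a b c; lia.
move=> /andP[/allP js /IH {}IH]; apply: sorted_nseq_cat => // k.
move=> /flattenP[t /mapP[l ls ->]].
by move=> /nseqP[-> _]; apply/ltnW/js.
Qed.

Lemma dec_wordK A : sorted ge_ord A -> dec_word (fun j => count_mem j A) = A.
Proof.
move=> dec; apply: (sorted_eq ge_ord_trans) => //.
- by move=> a b /andP[ab ba]; apply/val_inj/eqP; rewrite eqn_leq ab ba.
- exact: sorted_dec_word.
- by rewrite /perm_eq; apply/allP => j _ /=; rewrite count_dec_word.
Qed.

Lemma inc_wordK B : sorted lt_ord B -> inc_word (mem B) = B.
Proof.
move=> inc; apply: (irr_sorted_eq lt_ord_trans) => //.
- by move=> a /=; exact: ltnn.
- exact: sorted_inc_word.
- by move=> j; rewrite mem_inc_word.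
Qed.

End HookWords.

(** * Dual marginally large tableaux as families of row tails *)

Section Tableaux.
Variable n : nat.
Implicit Types (w : 'I_n -> seq 'I_n) (A B : seq 'I_n) (T : tableau n) (i x : 'I_n).

(** The length of the row of the letter [m.-1]: the initial run of a row is one
    longer than the row below it, so each row adds its tail and one box to the
    length of the row below. *)
Definition row_size w (m : nat) : nat := (\sum_(j < n | (j < m)%N) (size (w j)).+1)%N.

Definition row_of w i : seq 'I_n := nseq (row_size w i).+1 i ++ w i.

Definition tableau_of w : tableau n := [seq row_of w i | i <- rev (enum 'I_n)].

Lemma row_size0 w : row_size w 0 = 0%N.
Proof. by rewrite /row_size big_pred0. Qed.

Lemma row_sizeS w i : row_size w i.+1 = ((row_size w i).+1 + size (w i))%N.
Proof.
rewrite /row_size (bigD1 i) //= addnC -addSnnS addnC addSn addnC addSn; congr (_ + _).+1.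
by apply: eq_bigl => j; rewrite ltnS ltn_neqAle andbC.
Qed.

Lemma size_row_of w i : size (row_of w i) = row_size w i.+1.
Proof. by rewrite size_cat size_nseq row_sizeS. Qed.

Lemma size_tableau_of w : size (tableau_of w) = n.
Proof. by rewrite size_map size_rev size_enum_ord. Qed.

Lemma trow_tableau_of w i : trow (tableau_of w) (rev_ord i) = row_of w i.
Proof.
rewrite /trow (nth_map i) ?size_rev ?size_enum_ord //.
have lt_in := ltn_ord i.
rewrite nth_rev ?size_enum_ord //=; last lia.
by congr row_of; apply/val_inj; rewrite /= nth_enum_ord; lia.
Qed.

Lemma trow_below T i : size T = n ->
  (exists2 j : 'I_n, i = j.+1 :> nat & trow T (rev_ord i).+1 = trow T (rev_ord j)) \/
  (i = 0%N :> nat /\ trow T (rev_ord i).+1 = [::]).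
Proof.
move=> sT; case: i => [[|m] im]; [right|left].
  by split=> //; apply: nth_default; rewrite sT /=; lia.
have mn : (m < n)%N by exact: ltnW.
by exists (Ordinal mn); [|congr trow; rewrite /=; lia].
Qed.

Lemma size_trow_below w i :
  size (trow (tableau_of w) (rev_ord i).+1) = row_size w i.
Proof.
have [[j -> ->]|[-> ->]] := trow_below i (size_tableau_of w).
  by rewrite trow_tableau_of size_row_of.
by rewrite row_size0.
Qed.

Lemma row_of_le w i : row_tail i (w i) -> {in row_of w i, forall x, (x <= i)%N}.
Proof. by move=> [_ le _] x; rewrite mem_cat => /orP[/nseqP[-> _]|/le]. Qed.

Lemma rev_ordP (k : nat) : (k < n)%N -> exists i : 'I_n, k = rev_ord i.
Proof. by move=> kn; exists (rev_ord (Ordinal kn)); rewrite rev_ordK. Qed.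

(** Any family of row tails occurs: the long initial runs make the condition on
    hook subwords automatic. *)
Lemma tableau_of_SDT w :
  (forall i, row_tail i (w i)) -> SDT_minus_infty n (tableau_of w).
Proof.
move=> tl; have sT := size_tableau_of w.
have hook i : dec_inc (row_of w i) by exact: row_tail_dec_inc_nseq.
have hookw i : hook_word (row_of w i) by exact: dec_inc_hook.
split; [split|split=> // i].
- apply/andP; split.
    apply/(sortedP 0%N) => k; rewrite size_map sT => kn.
    rewrite !(nth_map [::]) ?sT //; last exact: ltnW.
    have [i kE] := rev_ordP (ltnW kn); rewrite -!/(trow _ _) kE.
    by rewrite size_trow_below trow_tableau_of size_row_of row_sizeS /= ltnS leq_addr.
  by apply/negP => /mapP[u /mapP[i _ ->]]; rewrite size_row_of row_sizeS.
- move=> k; rewrite sT => kn; have [i ->] := rev_ordP kn.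
  rewrite trow_tableau_of; split=> //; split=> //; first exact: suffix_subseq.
  move=> u sub /hook_dec_inc hu.
  move: sub; rewrite /row_of -size_trow_below; set v := trow _ _ => sub.
  apply: (hook_subword_bound _ _ sub hu); last by case: (tl i).
  rewrite /v; have [[j ij ->]|[_ ->]] := trow_below i sT; last by [].
  by rewrite trow_tableau_of => x /(row_of_le (tl j)); rewrite ij ltnS.
- rewrite trow_tableau_of size_trow_below; apply: initial_run_nseq.
  by case: (tl i).
Qed.

(** A tableau is rebuilt from its row tails, from the bottom row up, since the
    length of an initial run is dictated by the row below. *)
Lemma SDT_tableau_of T : SDT_minus_infty n T ->
  exists2 w, forall i, row_tail i (w i) & T = tableau_of w.
Proof.
move=> [[_ hk] [sT run]].
have hookT i : dec_inc (trow T (rev_ord i)).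
  by apply: hook_dec_inc; case: (hk (rev_ord i)); rewrite ?sT.
have headT i : exists u, trow T (rev_ord i) = i :: u.
  have := run i; case: (trow T _) => [|x u] //; rewrite /initial_run /=.
  by case: eqP => //= -> _; exists u.
(* A letter larger than i in the row of i could be prepended to the row above,
   which starts with the letter after i: a longer hook subword. *)
have leT i : {in trow T (rev_ord i), forall x, (x <= i)%N}.
  move=> x xT; rewrite leqNgt; apply/negP => ix.
  have jn : (i.+1 < n)%N by exact: leq_ltn_trans ix (ltn_ord x).
  pose j := Ordinal jn; have rj : (rev_ord j).+1 = rev_ord i by rewrite /=; lia.
  have jT : (rev_ord j < size T)%N by rewrite sT.
  have [_ [_ _ /(_ (x :: trow T (rev_ord j)))]] := hk _ jT.
  rewrite rj /= ltnn => F; suff: false by []; apply: F.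
    by apply: (@cat_subseq _ [:: x]); rewrite ?sub1seq.
  apply: dec_inc_hook => //; have [u uE] := headT j.
  case: (hookT j) => [A [B [E dec inc]]].
  exists (x :: A), B; split=> //; first by rewrite E.
  case: A E dec => //= a A E dec; rewrite dec andbT.
  by move: E; rewrite uE => -[<- _].
have rowE i : exists2 w, trow T (rev_ord i) =
    nseq (size (trow T (rev_ord i).+1)).+1 i ++ w & row_tail i w.
  exact: row_tail_of_row.
have [w wE tl] := fin_all_exists2 rowE; exists w => //.
have below m : (m <= n)%N -> size (trow T (n - m)) = row_size w m.
  elim: m => [|m IH] mn; first by rewrite subn0 /trow nth_default ?sT ?row_size0.
  pose i := Ordinal mn.
  rewrite -[(n - m.+1)%N]/(val (rev_ord i)) wE size_cat size_nseq.
  have -> : (rev_ord i).+1 = (n - m)%N by rewrite /=; lia.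
  by rewrite IH 1?ltnW // -[m.+1]/(i.+1) row_sizeS.
apply: (@eq_from_nth _ [::]); first by rewrite sT size_tableau_of.
move=> k; rewrite sT => kn; rewrite -!/(trow _ _).
have [i ->] := rev_ordP kn; rewrite trow_tableau_of wE /row_of.
have -> : (rev_ord i).+1 = (n - i)%N by rewrite /=; have := ltn_ord i; lia.
by rewrite below // ltnW.
Qed.

Lemma tableau_of_inj w w' :
  (forall i, row_tail i (w i)) -> (forall i, row_tail i (w' i)) ->
  tableau_of w = tableau_of w' -> w =1 w'.
Proof.
move=> tl tl' E i; have : row_of w i = row_of w' i by rewrite -!trow_tableau_of E.
rewrite /row_of => R; have := congr1 (initial_run i) R.
rewrite !initial_run_nseq; [|by case: (tl' i)|by case: (tl i)].
by move=> rE; move: R; rewrite rE => /eqP; rewrite eqseq_cat // => /andP[_ /eqP].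
Qed.

Lemma sum_count (s : seq 'I_n) :
  \sum_(j < n) (count_mem j s)%:Z *: eps j = \sum_(x <- s) eps x.
Proof.
elim: s => [|x s IH]; first by rewrite big_nil big1 // => j _; rewrite scale0r.
rewrite big_cons -IH (bigD1 x) //= eqxx [in RHS](bigD1 x) //= addrA PoszD.
rewrite scalerDl scale1r; congr (_ + _); apply: eq_bigr => j jx.
by rewrite eq_sym (negbTE jx).
Qed.

Lemma sum_nseq (k : nat) i (F : 'I_n -> 'rV[int]_n) :
  \sum_(x <- nseq k i) F x = F i *+ k.
Proof. by rewrite big_nseq iter_addr_0. Qed.

(** The initial runs agree with the tableau filled with one letter in each row,
    so only the tails contribute. *)
Lemma wt_tableau_of w :
  wt (tableau_of w) = \sum_(i < n) \sum_(x <- w i) (eps x - eps i).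
Proof.
rewrite /wt; under eq_bigr do rewrite scalerBl.
rewrite big_split sumrN !sum_count !big_flatten !big_map big_rev !big_enum /=.
rewrite [X in _ - X](reindex_inj rev_ord_inj) -sumrB; apply: eq_bigr => i _.
rewrite trow_tableau_of size_row_of row_sizeS rev_ordK sumrB /row_of big_cat.
rewrite !sum_nseq mulrnDr opprD addrACA subrr add0r; congr (_ - _).
by rewrite big_const_seq count_predT iter_addr_0.
Qed.

(** * Tableaux and multiplicities of roots *)

Lemma sum_dec_word (m : 'I_n -> nat) (F : 'I_n -> 'rV[int]_n) :
  \sum_(x <- dec_word m) F x = \sum_j F j *+ m j.
Proof.
rewrite /dec_word big_flatten big_map big_rev big_enum /=.
by apply: eq_bigr => j _; rewrite sum_nseq.
Qed.

Lemma sum_inc_word (e : 'I_n -> bool) (F : 'I_n -> 'rV[int]_n) :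
  \sum_(x <- inc_word e) F x = \sum_j F j *+ e j.
Proof.
rewrite /inc_word big_filter big_enum_cond big_mkcond /=.
by apply: eq_bigr => j _; case: (e j); rewrite ?mulr1n.
Qed.

Lemma sum_tail_of i A B :
  \sum_(x <- tail_of i A B) (eps x - eps i) =
  \sum_(x <- A) (eps x - eps i) + \sum_(x <- B) (eps x - eps i).
Proof.
rewrite /tail_of !big_cat /= addrA; case: B => [|b B]; first by rewrite big_nil addr0.
by rewrite sum_nseq subrr mul0rn addr0.
Qed.

Local Notation pairs := (enum [pred p : 'I_n * 'I_n | (p.1 < p.2)%N]).
Local Notation D := (choices 0%N pairs `*` choices false pairs).

(** A letter j < i in the tail of the row of i has weight [eps j - eps i], the root
    of the pair (j, i): its multiplicity in the geometric series goes to the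
    decreasing part and the choice in 1 + e^a to the increasing part. *)
Definition SDT_of
    (x : {ffun 'I_n * 'I_n -> nat} * {ffun 'I_n * 'I_n -> bool}) : tableau n :=
  tableau_of (fun i => tail_of i (dec_word (fun j => x.1 (j, i)))
                              (inc_word (fun j => x.2 (j, i)))).

Lemma choices_dec_below (f : {ffun 'I_n * 'I_n -> nat}) i :
  choices 0%N pairs f -> dec_below i (dec_word (fun j => f (j, i))).
Proof.
move=> fs; split=> [|j]; first exact: sorted_dec_word.
rewrite mem_dec_word; apply: contraTT => ji; rewrite fs //.
by rewrite mem_enum inE.
Qed.

Lemma choices_inc_below (f : {ffun 'I_n * 'I_n -> bool}) i :
  choices false pairs f -> inc_below i (inc_word (fun j => f (j, i))).
Proof.
move=> fs; split=> [|j]; first exact: sorted_inc_word.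
by rewrite mem_inc_word; apply: contraTT => ji; rewrite fs // mem_enum inE.
Qed.

Lemma SDT_of_bij : set_bij D (SDT_minus_infty n) SDT_of.
Proof.
have tl (x : {ffun 'I_n * 'I_n -> nat} * {ffun 'I_n * 'I_n -> bool}) i :
    D x -> row_tail i (tail_of i (dec_word (fun j => x.1 (j, i)))
                                 (inc_word (fun j => x.2 (j, i)))).
  by move=> [? ?]; apply: row_tail_tail_of;
    [exact: choices_dec_below|exact: choices_inc_below].
split.
- by move=> x Dx; apply: tableau_of_SDT => i; exact: tl.
- move=> x y; rewrite !inE => Dx Dy E.
  have {}E i := tableau_of_inj (fun i => tl x i Dx) (fun i => tl y i Dy) E i.
  case: Dx Dy => [x1 x2] [y1 y2].
  have {}E i := tail_of_inj (choices_dec_below i x1) (choices_inc_below i x2)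
                         (choices_dec_below i y1) (choices_inc_below i y2) (E i).
  rewrite [x]surjective_pairing [y]surjective_pairing.
  congr pair; apply/ffunP => -[j i]; have [EA EB] := E i.
    by rewrite -(count_dec_word (fun j => x.1 (j, i))) EA count_dec_word.
  by rewrite -(mem_inc_word (fun j => x.2 (j, i))) EB mem_inc_word.
- move=> T /SDT_tableau_of[w wtl ->].
  have ex i : exists AB : seq 'I_n * seq 'I_n,
      [/\ dec_below i AB.1, inc_below i AB.2 & w i = tail_of i AB.1 AB.2].
    by have [A [B ?]] := tail_of_surj (wtl i); exists (A, B).
  have [AB ABE] := fin_all_exists ex.
  exists ([ffun p => count_mem p.1 (AB p.2).1], [ffun p => p.1 \in (AB p.2).2]).
    split=> -[j i]; rewrite mem_enum inE /= ffunE /= => ji.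
      apply/count_memPn; apply: contraNN ji.
      by case: (ABE i) => -[_ h] _ _ /h.
    by apply: contraNF ji; case: (ABE i) => _ [_ h] _ /h.
  apply: eq_map => i; rewrite /row_of /row_size.
  have E k : tail_of k (dec_word (fun j => [ffun p => count_mem p.1 (AB p.2).1] (j, k)))
      (inc_word (fun j => [ffun p => p.1 \in (AB p.2).2] (j, k))) = w k.
    case: (ABE k) => -[dec _] [inc _] ->; congr tail_of.
      rewrite -[RHS]dec_wordK //; congr dec_word.
      by apply/funext => j; rewrite ffunE.
    rewrite -[RHS]inc_wordK //; congr inc_word.
    by apply/funext => j; rewrite ffunE.
  by rewrite E; congr (nseq _.+1 _ ++ _); apply: eq_bigr => k _; rewrite E.
Qed.

Lemma wt_SDT_of
    (x : {ffun 'I_n * 'I_n -> nat} * {ffun 'I_n * 'I_n -> bool}) :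
  D x -> wt (SDT_of x) = mult_weight x.
Proof.
move=> [x1 x2]; rewrite wt_tableau_of /mult_weight big_enum /=.
have -> : \sum_(p : 'I_n * 'I_n | (p.1 < p.2)%N) root_of p *+ (x.1 p + x.2 p) =
          \sum_(p : 'I_n * 'I_n) root_of p *+ (x.1 p + x.2 p).
  rewrite [RHS](bigID (fun p : 'I_n * 'I_n => (p.1 < p.2)%N)) /=.
  rewrite [X in _ + X]big1 ?addr0 // => p np.
  by rewrite x1 ?x2 ?mem_enum ?inE // mulr0n.
transitivity (\sum_j \sum_i root_of (j, i) *+ (x.1 (j, i) + x.2 (j, i))); last first.
  by rewrite pair_bigA; apply: eq_bigr => -[].
rewrite exchange_big; apply: eq_bigr => i _.
rewrite sum_tail_of (sum_dec_word _ (fun j => eps j - eps i)).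
rewrite (sum_inc_word _ (fun j => eps j - eps i)) -big_split.
by apply: eq_bigr => j _; rewrite mulrnDr.
Qed.

End Tableaux.

Theorem proposition3p15 (n : nat) (hn : (2 <= n)%N) :
  fsummable (SDT_minus_infty n) (@wt n) /\
  fsum (SDT_minus_infty n) (@wt n) = ch_Uplus_q n.
Proof.
have [summ ->] := ch_Uplus_q_fsum n; have bij := SDT_of_bij n.
set D := _ `*` _ in summ bij *.
have E : {in D, @wt n \o @SDT_of n =1 @mult_weight n}.
  by move=> x; rewrite inE => Dx; exact: wt_SDT_of.
split; last by rewrite (fsum_reindex _ bij); exact: eq_fsum.
apply: (fsummable_reindex bij); exact: eq_fsummable summ.
Qed.
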